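(* Let $A\in\mathbb{R}^{n\times n}$ be an irreducible nonsingular $M$-matrix, $\mathbf{a}\in\mathbb{R}^n$ with $\mathbf{a}>0$, and $\Gamma>0$. Let $(\mathbf{u}_*,\lambda_* )$ be an eigenpair, i.e. $\mathcal{A}(\mathbf{u}_* )\mathbf{u}_*=\lambda_*\mathbf{u}_*$, with $\mathbf{u}_*>0$ and $\|\mathbf{u}_*\|=1$. Then there is $\varepsilon>0$ such that the following holds. Let $\{(\mathbf{u}_k,\lambda_k)\}$ be generated by the Newton-Noda iteration (described in the context), and suppose that for some $k_0$ the pair $(\mathbf{u}_{k_0},\lambda_{k_0})$ is within distance $\varepsilon$ of $(\mathbf{u}_*,\lambda_* )$. Then $\lambda_k$ converges to $\lambda_*$ quadratically and $\mathbf{u}_k$ converges to $\mathbf{u}_*$ quadratically.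
   Context: A sequence $x_k$ in a normed space converges quadratically to $x$ if $x_k\to x$ and there is a constant $C$ with $\|x_{k+1}-x\|\le C\|x_k-x\|^2$ for all sufficiently large $k$. Inequalities between vectors or matrices are entrywise; $\|\cdot\|$ is the 2-norm; $\mathbf{v}^{[m]}$ denotes the entrywise power and quotients of vectors are entrywise; $\mathbf{e}=[1,\dots,1]^T$; $\min(\mathbf{v})=\min_i v_i$ and $\min(\mathbf{w}/\mathbf{v})=\min_i w_i/v_i$. A $Z$-matrix is a real square matrix with nonpositive off-diagonal entries; an $M$-matrix is a (nonsingular) $Z$-matrix $A$ with $A^{-1}\ge 0$. $A$ is irreducible if there is no nonempty proper subset $S\subset\{1,\dots,n\}$ with $A_{ij}=0$ for all $i\in S$, $j\notin S$. For $\mathbf{u}\in\mathbb{R}^n$, $\lambda\in\mathbb{R}$ put $$\mathcal{A}(\mathbf{u})=A+\Gamma\,\mathrm{diag}\Big(\mathbf{e}-\frac{\mathbf{e}}{\mathbf{a}+\mathbf{u}^{[2]}}\Big),\quad \mathbf{r}(\mathbf{u},\lambda)=\mathcal{A}(\mathbf{u})\mathbf{u}-\lambda\mathbf{u},$$ $$J(\mathbf{u},\lambda)=A+(\Gamma-\lambda)I-\Gamma\,\mathrm{diag}\Big(\frac{\mathbf{a}-\mathbf{u}^{[2]}}{(\mathbf{a}+\mathbf{u}^{[2]})^{[2]}}\Big).$$ Newton-Noda iteration (run without a stopping test): given $\mathbf{u}_0>0$ with $\|\mathbf{u}_0\|=1$, set $\lambda_0=\min\big(\mathcal{A}(\mathbf{u}_0)\mathbf{u}_0/\mathbf{u}_0\big)$.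 For $k=0,1,2,\dots$: let $(\Delta_k,\delta_k)\in\mathbb{R}^n\times\mathbb{R}$ be the (unique) solution of $$\begin{bmatrix}J(\mathbf{u}_k,\lambda_k)&-\mathbf{u}_k\\-\mathbf{u}_k^T&0\end{bmatrix}\begin{bmatrix}\Delta_k\\ \delta_k\end{bmatrix}=-\begin{bmatrix}\mathbf{r}(\mathbf{u}_k,\lambda_k)\\ \tfrac12(1-\mathbf{u}_k^T\mathbf{u}_k)\end{bmatrix};$$ choose $\theta_k\in(0,1]$ by the rule below; set $\mathbf{w}_{k+1}=\mathbf{u}_k+\theta_k\Delta_k$, $\mathbf{u}_{k+1}=\mathbf{w}_{k+1}/\|\mathbf{w}_{k+1}\|$, $\lambda_{k+1}=\min\big(\mathcal{A}(\mathbf{u}_{k+1})\mathbf{u}_{k+1}/\mathbf{u}_{k+1}\big)$. Rule for $\theta_k$: for $\theta\in(0,1]$ set $\mathbf{w}_k(\theta)=\mathbf{u}_k+\theta\Delta_k$, $\mathbf{h}_k(\theta)=\mathbf{r}\big(\mathbf{w}_k(\theta)/\|\mathbf{w}_k(\theta)\|,\lambda_k\big)$ and $\mathbf{R}_k(\theta)=\mathbf{h}_k(\theta)-\frac{1-\theta}{\|\mathbf{w}_k(\theta)\|}\mathbf{r}(\mathbf{u}_k,\lambda_k)-\frac{\theta\delta_k}{\|\mathbf{w}_k(\theta)\|}\mathbf{u}_k$. $\eta>0$ is a fixed constant, and $M>0$ is a fixed constant such that $\|\mathbf{R}_k(\theta)\|\le M\theta^2\|\Delta_k\|^2$ for every unit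 vector $\mathbf{u}_k>0$ (with $\lambda_k=\min(\mathcal{A}(\mathbf{u}_k)\mathbf{u}_k/\mathbf{u}_k)$) and every $\theta\in(0,1]$. Then $\theta_k=1$ if $\mathbf{h}_k(1)\ge\frac{\delta_k\mathbf{u}_k}{(1+\eta)\|\mathbf{w}_k(1)\|}$, and otherwise $\theta_k=\eta_k:=\frac{\eta\,\delta_k\min(\mathbf{u}_k)}{(1+\eta)M\|\mathbf{w}_k(1)\|\|\Delta_k\|^2}$. *)

(* Defs.v *)
From mathcomp Require Export all_boot all_order all_algebra.
From mathcomp Require Export all_classical all_reals all_analysis.
Export Order.TTheory GRing.Theory Num.Theory numFieldNormedType.Exports.

Set Implicit Arguments.
Unset Strict Implicit.
Unset Printing Implicit Defensive.

Global Open Scope classical_set_scope.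
Global Open Scope ring_scope.

Section Entrywise.
Context {R : realType}.

Definition mx_le m n (X Y : 'M[R]_(m, n)) : bool :=
  [forall i, [forall j, X i j <= Y i j]].

Definition mx_lt m n (X Y : 'M[R]_(m, n)) : bool :=
  [forall i, [forall j, X i j < Y i j]].

Definition vpow n (v : 'cV[R]_n) (m : nat) : 'cV[R]_n :=
  map_mx (fun x => x ^+ m) v.

Definition vdiv n (v w : 'cV[R]_n) : 'cV[R]_n :=
  map2_mx (fun x y => x / y) v w.

Definition vdiag n (v : 'cV[R]_n) : 'M[R]_n := diag_mx v^T.

(* The default value of the iterated minimum is itself an entry of [v], so it
   does not affect the result. *)
Definition vmin n (v : 'cV[R]_n.+1) : R :=
  \big[Num.min/v ord0 0]_(i < n.+1) v i 0.

(* The library's norm on matrices is the sup norm, hence this 2-norm. *)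
Definition norm2 n (v : 'cV[R]_n) : R :=
  Num.sqrt (\sum_(i < n) v i 0 ^+ 2).

End Entrywise.

Definition converges_quadratically (R : realType) (V : zmodType) (N : V -> R)
    (x : nat -> V) (l : V) : Prop :=
  N (x k - l) @[k --> \oo] --> (0 : R) /\
  exists C : R, \forall k \near \oo, N (x k.+1 - l) <= C * N (x k - l) ^+ 2.

Section MatrixClasses.
Context {R : realType}.

Definition Z_matrix n (A : 'M[R]_n) : Prop :=
  forall i j, i != j -> A i j <= 0.

Definition nonsingular_M_matrix n (A : 'M[R]_n) : Prop :=
  [/\ Z_matrix A, A \in unitmx & mx_le 0 (invmx A)].

Definition irreducible_mx n (A : 'M[R]_n) : Prop :=
  ~ exists S : {set 'I_n},
      [/\ S != finset.set0, S \proper finset.setT &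
          forall i j, i \in S -> j \notin S -> A i j = 0].

End MatrixClasses.

Section NewtonNoda.
Context {R : realType} {n : nat}.
Variables (A : 'M[R]_n.+1) (a : 'cV[R]_n.+1) (Gamma : R).

Local Notation vec := 'cV[R]_n.+1.
Local Notation e := (const_mx 1 : vec).

Definition calA (u : vec) : 'M[R]_n.+1 :=
  A + Gamma *: vdiag (e - vdiv e (a + vpow u 2)).

Definition res (u : vec) (lambda : R) : vec :=
  calA u *m u - lambda *: u.

Definition jac (u : vec) (lambda : R) : 'M[R]_n.+1 :=
  A + (Gamma - lambda)%:M
    - Gamma *: vdiag (vdiv (a - vpow u 2) (vpow (a + vpow u 2) 2)).

Definition noda_value (u : vec) : R := vmin (vdiv (calA u *m u) u).

Definition newton_system (u : vec) (lambda : R) (Delta : vec) (delta : R)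
    : Prop :=
  block_mx (jac u lambda) (- u) (- u^T) 0 *m col_mx Delta delta%:M
  = - col_mx (res u lambda) (2^-1 *: (1%:M - u^T *m u)).

Definition wvec (u Delta : vec) (theta : R) : vec := u + theta *: Delta.

Definition normalize (w : vec) : vec := (norm2 w)^-1 *: w.

Definition hvec (u : vec) (lambda : R) (Delta : vec) (theta : R) : vec :=
  res (normalize (wvec u Delta theta)) lambda.

Definition Rvec (u : vec) (lambda : R) (Delta : vec) (delta theta : R) : vec :=
  hvec u lambda Delta theta
    - ((1 - theta) / norm2 (wvec u Delta theta)) *: res u lambda
    - (theta * delta / norm2 (wvec u Delta theta)) *: u.

Definition remainder_bound (M : R) : Prop :=
  forall (u Delta : vec) (delta theta : R),
    mx_lt 0 u -> norm2 u = 1 ->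
    newton_system u (noda_value u) Delta delta ->
    0 < theta <= 1 ->
    norm2 (Rvec u (noda_value u) Delta delta theta)
      <= M * theta ^+ 2 * norm2 Delta ^+ 2.

Definition full_step (eta : R) (u : vec) (lambda : R) (Delta : vec) (delta : R)
    : bool :=
  mx_le ((delta / ((1 + eta) * norm2 (wvec u Delta 1))) *: u)
        (hvec u lambda Delta 1).

Definition damped_step (eta M : R) (u Delta : vec) (delta : R) : R :=
  (eta * delta * vmin u)
    / ((1 + eta) * M * norm2 (wvec u Delta 1) * norm2 Delta ^+ 2).

Definition step_length (eta M : R) (u : vec) (lambda : R)
    (Delta : vec) (delta : R) : R :=
  if full_step eta u lambda Delta delta then 1
  else damped_step eta M u Delta delta.

(* The bordered matrix is invertible whenever [u k > 0], so [newton_system]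
   determines [Delta k] and [delta k]. *)
Definition newton_noda (eta M : R) (u : nat -> vec) (lambda : nat -> R)
    (Delta : nat -> vec) (delta theta : nat -> R) : Prop :=
  [/\ mx_lt 0 (u 0%N), norm2 (u 0%N) = 1,
      forall k, lambda k = noda_value (u k) &
      forall k,
        [/\ newton_system (u k) (lambda k) (Delta k) (delta k),
            theta k = step_length eta M (u k) (lambda k) (Delta k) (delta k),
            0 < theta k <= 1 &
            u k.+1 = normalize (wvec (u k) (Delta k) (theta k))]].

End NewtonNoda.

(* Main.v *)
Require Import Defs.
From mathcomp Require Import ring lra.

(* Write v = u - us for a unit vector u close to us. The Jacobian J at
   (u, noda u) is a Z-matrix with J u bounded below by a positive constant, so it
   is monotone; this alone bounds the solutions x of J x >= -k, u^T x <= k by a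
   multiple of k, with constants independent of u. Two consequences are drawn
   from Taylor expansions at u, using that u^T v = |v|^2 / 2 is of second order:
   the gap ls - noda u is at least a multiple of |v|, and the Newton update has
   an error of order |v|^2. Hence delta is at least a multiple of |v| while the
   remainder is of order |v|^2, so near us the full step is always accepted; and
   |v| and |noda u - ls| are comparable, so both converge quadratically. *)

Set Implicit Arguments.
Unset Strict Implicit.
Unset Printing Implicit Defensive.

(** * Lipschitz and second-order bounds for the scalar nonlinearity x / (a + x^2) *)

Section Saturation.
Context {R : realType}.
Implicit Types a x y : R.

Definition sat a x : R := x / (a + x ^+ 2).
(** The derivative of [sat a] at [x]. *)
Definition dsat a x : R := (a - x ^+ 2) / (a + x ^+ 2) ^+ 2.

Lemma addr_sqr_gt0 a x : 0 < a -> 0 < a + x ^+ 2.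
Proof. by move=> a0; rewrite ltr_wpDr ?sqr_ge0. Qed.

Lemma norm_dsat a x : 0 < a -> `|dsat a x| <= a^-1.
Proof.
move=> a0; have d0 := addr_sqr_gt0 x a0; have x2 := sqr_ge0 x.
rewrite /dsat normrM normfV [X in _ / X]ger0_norm ?sqr_ge0 //.
rewrite ler_pdivrMr ?exprn_gt0 //.
apply: (@le_trans _ _ (a + x ^+ 2)); first by rewrite ler_norml; lra.
by rewrite expr2 mulrA ler_peMl ?(ltW d0) // mulrC ler_pdivlMr // mul1r; lra.
Qed.

Lemma sat_lipschitz a x y : 0 < a -> `|x| <= 1 -> `|y| <= 1 ->
  `|sat a x - sat a y| <= (1 + a) / a ^+ 2 * `|x - y|.
Proof.
move=> a0 x1 y1; have dx := addr_sqr_gt0 x a0; have dy := addr_sqr_gt0 y a0.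
have -> : sat a x - sat a y =
    (a - x * y) / ((a + x ^+ 2) * (a + y ^+ 2)) * (x - y).
  by rewrite /sat; field; rewrite !gt_eqF.
rewrite normrM ler_wpM2r // normrM normfV.
rewrite (ger0_norm (ltW (mulr_gt0 dx dy))).
apply: ler_pM => //; first by rewrite invr_ge0 ltW ?mulr_gt0.
  rewrite (le_trans (ler_normB _ _)) // addrC (gtr0_norm a0) lerD2r normrM.
  by rewrite mulr_ile1.
rewrite lef_pV2 ?posrE ?exprn_gt0 ?mulr_gt0 // expr2.
by rewrite ler_pM ?lerDl ?sqr_ge0 ?(ltW a0).
Qed.

(** The remainder is exactly a rational coefficient times (x - y)^2; on [-1, 1] its numerator is at
    most 1 + 3a and its denominator at least a^3. The expansion point is [y]. *)
Lemma sat_taylor a x y : 0 < a -> `|x| <= 1 -> `|y| <= 1 ->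
  `|sat a x - sat a y - dsat a y * (x - y)|
    <= (1 + 3 * a) / a ^+ 3 * (x - y) ^+ 2.
Proof.
move=> a0 x1 y1; have dx := addr_sqr_gt0 x a0; have dy := addr_sqr_gt0 y a0.
have d0 : 0 < (a + x ^+ 2) * (a + y ^+ 2) ^+ 2 by rewrite mulr_gt0 ?exprn_gt0.
have -> : sat a x - sat a y - dsat a y * (x - y) =
    (x * y ^+ 2 - (2 * a * y + a * x)) /
      ((a + x ^+ 2) * (a + y ^+ 2) ^+ 2) * (x - y) ^+ 2.
  by rewrite /sat /dsat; field; rewrite !gt_eqF.
rewrite normrM (ger0_norm (sqr_ge0 _)) ler_wpM2r ?sqr_ge0 //.
rewrite normrM normfV (gtr0_norm d0).
apply: ler_pM => //; first by rewrite invr_ge0 ltW.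
  rewrite (le_trans (ler_normB _ _)) // lerD //.
    by rewrite normrM normrX mulr_ile1 ?exprn_ile1 ?exprn_ge0.
  rewrite (le_trans (ler_normD _ _)) // !normrM (gtr0_norm a0).
  rewrite (@ger0_norm _ 2) //; nra.
rewrite lef_pV2 ?posrE ?exprn_gt0 // exprS.
apply: ler_pM; rewrite ?exprn_ge0 ?(ltW a0) ?lerDl ?sqr_ge0 //.
by rewrite lerXn2r ?nnegrE ?(ltW a0) ?(ltW dy) ?lerDl ?sqr_ge0.
Qed.

End Saturation.

(** * The Euclidean norm and its comparison with entrywise bounds *)

Section Norm2.
Context {R : realType} {n : nat}.
Implicit Types u v : 'cV[R]_n.

Lemma norm2_ge0 v : 0 <= norm2 v.
Proof. exact: sqrtr_ge0. Qed.

Lemma sqr_norm2 v : norm2 v ^+ 2 = \sum_i v i 0 ^+ 2.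
Proof. by rewrite sqr_sqrtr // sumr_ge0 // => i _; rewrite sqr_ge0. Qed.

Lemma ler_sum_term (F : 'I_n -> R) i : (forall j, 0 <= F j) -> F i <= \sum_j F j.
Proof. by move=> F0; rewrite (bigD1 i) //= lerDl sumr_ge0. Qed.

Lemma norm_entry_le v i : `|v i 0| <= norm2 v.
Proof.
rewrite -ler_sqr ?nnegrE ?norm2_ge0 // real_normK ?num_real // sqr_norm2.
by apply: (@ler_sum_term (fun i => v i 0 ^+ 2)) => j; rewrite sqr_ge0.
Qed.

Lemma norm2_le v t : (forall i, `|v i 0| <= t) -> norm2 v <= n%:R * t.
Proof.
(* A negative [t] is possible only for the empty vector, where both sides vanish. *)
move=> vt; have [t0|t_lt0] := leP 0 t; last first.
  case: n v vt => [v _|k v /(_ ord0) /le_lt_trans /(_ t_lt0)].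
    by rewrite /norm2 big_ord0 sqrtr0 mul0r.
  by rewrite normr_lt0.
rewrite -ler_sqr ?nnegrE ?norm2_ge0 ?mulr_ge0 // sqr_norm2 exprMn.
apply: (@le_trans _ _ (\sum_(i < n) t ^+ 2)).
  by apply: ler_sum => i _; rewrite -(real_normK (num_real (v i 0))) lerXn2r ?nnegrE.
rewrite sumr_const card_ord -[leLHS]mulr_natl ler_wpM2r ?sqr_ge0 //.
by rewrite -natrX ler_nat -mulnn; case: (posnP n) => [->|/leq_pmulr ->].
Qed.

Lemma norm2_eq0 v : norm2 v = 0 -> v = 0.
Proof.
move=> v0; apply/matrixP => i j; rewrite ord1 mxE; apply/eqP.
by rewrite -normr_le0 -v0 norm_entry_le.
Qed.

Lemma norm20 : norm2 (0 : 'cV[R]_n) = 0.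
Proof. by rewrite /norm2 big1 ?sqrtr0 // => i _; rewrite mxE expr0n. Qed.

(** Summing u(u - v) = ((u - v)^2 + u^2 - v^2) / 2 over the entries, the last two terms cancel. Thus
    the difference of two unit vectors is orthogonal to either one up to second order. *)
Lemma dot_subr u v : norm2 u = 1 -> norm2 v = 1 ->
  \sum_i u i 0 * (u - v) i 0 = 2^-1 * norm2 (u - v) ^+ 2.
Proof.
move=> u1 v1; rewrite sqr_norm2.
have : norm2 u ^+ 2 - norm2 v ^+ 2 = 0 by rewrite u1 v1 subrr.
rewrite !sqr_norm2 -sumrB => e0.
transitivity (2^-1 * (\sum_i (u - v) i 0 ^+ 2
    + \sum_i (u i 0 ^+ 2 - v i 0 ^+ 2))); last by rewrite e0 addr0.
rewrite -big_split mulr_sumr; apply: eq_bigr => i _; rewrite !mxE /=.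
by field.
Qed.

End Norm2.

Lemma norm2_normalize (R : realType) n (v : 'cV[R]_n.+1) :
  v != 0 -> norm2 (normalize v) = 1.
Proof.
move=> v0; have nv0 : norm2 v != 0 by apply: contraNneq v0 => /norm2_eq0 ->.
apply/eqP; rewrite -(@eqrXn2 _ 2) ?norm2_ge0 // expr1n sqr_norm2.
under eq_bigr do rewrite mxE exprMn.
by rewrite -mulr_sumr -sqr_norm2 exprVn mulVf // expf_neq0.
Qed.

(** * Monotonicity and stability of Z-matrices with a positive witness *)

Section ZMatrices.
Context {R : realType} {n : nat}.
Implicit Types (J : 'M[R]_n) (u x : 'cV[R]_n).

(** Let [i] minimise x_i / u_i and suppose the minimum [q] is negative. Then x - q u is nonnegative
    and vanishes at [i], so the sign pattern makes row [i] of J (x - q u) nonpositive, whereas J x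
    >= 0 and - q J u > 0 make it positive. *)
Lemma Z_matrix_monotone J u x : Z_matrix J ->
  (forall i, 0 < u i 0) -> (forall i, 0 < (J *m u) i 0) ->
  (forall i, 0 <= (J *m x) i 0) -> forall i, 0 <= x i 0.
Proof.
move=> ZJ u0 Ju0 Jx0 i0; rewrite leNgt; apply/negP => xi0.
have [i _ imin] := @arg_minP _ _ _ i0 predT (fun i => x i 0 / u i 0) isT.
set q := x i 0 / u i 0 in imin.
have q0 : q < 0.
  by apply: le_lt_trans (imin i0 isT) _; rewrite pmulr_llt0 ?invr_gt0.
have : (J *m (x - q *: u)) i 0 <= 0.
  rewrite mxE; apply: sumr_le0 => j _; have [->|ji] := eqVneq j i.
    by rewrite !mxE /q divfK ?gt_eqF // subrr mulr0.
  rewrite mulr_le0_ge0 ?ZJ 1?eq_sym // !mxE subr_ge0.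
  by rewrite -ler_pdivlMr // imin.
apply/negP; rewrite -ltNge mulmxBr -scalemxAr.
rewrite [X in _ < X]mxE [X in _ < _ + X]mxE [X in _ < _ - X]mxE.
by rewrite ltr_wpDl // oppr_gt0 nmulr_rlt0.
Qed.

(* Monotonicity bounds [x] from below by a multiple of [u]; the bound on the
   inner product with [u] then controls [x] from above. *)
Lemma Z_matrix_stable J u x (c m k : R) : Z_matrix J -> 0 < c -> 0 < m -> 0 <= k ->
  norm2 u = 1 -> (forall i, m <= u i 0) -> (forall i, c <= (J *m u) i 0) ->
  (forall i, - k <= (J *m x) i 0) -> \sum_i u i 0 * x i 0 <= k ->
  forall i, `|x i 0| <= (1 + c^-1) / m * k.
Proof.
move=> ZJ c0 m0 k0 u1 mu cJ Jx ux i.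
have ule1 j : u j 0 <= 1.
  by rewrite -u1 (le_trans (ler_norm _)) // norm_entry_le.
have ugt0 j : 0 < u j 0 by exact: lt_le_trans (mu j).
have kc0 : 0 <= k / c by rewrite divr_ge0 // ltW.
(* The shift by (k / c) u raises J x by at least [k], which makes the image nonnegative. *)
have y0 j : 0 <= (x + (k / c) *: u) j 0.
  apply: (@Z_matrix_monotone J u) => // l; first exact: lt_le_trans (cJ l).
  rewrite mulmxDr -scalemxAr [leRHS]mxE [X in _ <= _ + X]mxE.
  rewrite -lerBlDr sub0r (le_trans _ (Jx l)) // lerN2.
  by rewrite -{1}(divfK (lt0r_neq0 c0) k) ler_wpM2l.
have yk : \sum_j u j 0 * (x + (k / c) *: u) j 0 <= k * (1 + c^-1).
  under eq_bigr do rewrite !mxE mulrDr mulrCA -expr2.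
  by rewrite big_split /= -mulr_sumr -sqr_norm2 u1 expr1n mulr1 mulrDr mulr1 lerD2r.
(* All terms of the inner product are nonnegative, so each is bounded by the sum. *)
have yi : u i 0 * (x + (k / c) *: u) i 0 <= k * (1 + c^-1).
  apply: le_trans yk.
  apply: (@ler_sum_term _ _ (fun l => u l 0 * (x + (k / c) *: u) l 0)) => j.
  by rewrite mulr_ge0 // ltW.
have m1 : m <= 1 by exact: le_trans (mu i) _.
have c1 : 0 < 1 + c^-1 by rewrite addr_gt0 ?invr_gt0.
rewrite mulrAC ler_pdivlMr //.
have := y0 i; rewrite !mxE => yi0; rewrite !mxE in yi.
have cVk : k / c * u i 0 <= k * (1 + c^-1).
  by rewrite mulrDr mulr1 -[leLHS]add0r lerD // ler_piMr.
have [xi0|xi0] := leP 0 (x i 0).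
  rewrite (ger0_norm xi0) mulrC [leRHS]mulrC; apply: le_trans yi.
  by apply: ler_pM => //; [exact: ltW | rewrite lerDl mulr_ge0 // ltW].
rewrite (ltr0_norm xi0); apply: le_trans (ler_piMr _ m1) _.
  by rewrite oppr_ge0 ltW.
by rewrite [leRHS]mulrC; apply: le_trans cVk; lra.
Qed.

End ZMatrices.

(** * Entrywise formulas for the operator, its Jacobian and the Noda value *)

Section Entries.
Context {R : realType} {n : nat}.
Variables (A : 'M[R]_n.+1) (a : 'cV[R]_n.+1) (Gamma : R).
Implicit Types (u x : 'cV[R]_n.+1) (lambda : R).

Lemma calA_mulE u i : (calA A a Gamma u *m u) i 0 =
  (A *m u) i 0 + Gamma * (u i 0 - sat (a i 0) (u i 0)).
Proof.
rewrite /calA mulmxDl -scalemxAl /vdiag mul_diag_mx !mxE /sat.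
by congr (_ + _ * _); ring.
Qed.

Lemma jac_mulE u lambda x i : (jac A a Gamma u lambda *m x) i 0 =
  (A *m x) i 0 + (Gamma - lambda) * x i 0
    - Gamma * (dsat (a i 0) (u i 0) * x i 0).
Proof.
by rewrite /jac mulmxBl mulmxDl mul_scalar_mx -scalemxAl /vdiag mul_diag_mx !mxE.
Qed.

Lemma jac_Z_matrix u lambda : Z_matrix A -> Z_matrix (jac A a Gamma u lambda).
Proof.
move=> ZA i j ij; have := ZA i j ij.
by rewrite /jac /vdiag !mxE (negPf ij) !mulr0n mulr0 subr0 addr0.
Qed.

Lemma vmin_le (v : 'cV[R]_n.+1) i : vmin v <= v i 0.
Proof. exact: bigmin_le. Qed.

Lemma vmin_attained (v : 'cV[R]_n.+1) : exists i, vmin v = v i 0.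
Proof.
rewrite /vmin; elim/big_ind: _.
- by exists ord0.
- by move=> x y xi yi; rewrite minEle; case: ifP.
- by move=> i _; exists i.
Qed.

Lemma noda_res_ge0 u i : 0 < u i 0 ->
  0 <= res A a Gamma u (noda_value A a Gamma u) i 0.
Proof.
move=> u0; have := vmin_le (vdiv (calA A a Gamma u *m u) u) i.
rewrite -/(noda_value A a Gamma u) /vdiv [X in _ <= X]mxE ler_pdivlMr // => le_f.
by rewrite /res [leRHS]mxE [X in _ <= _ + X]mxE [X in _ <= _ - X]mxE subr_ge0.
Qed.

(** At an index attaining the minimal ratio the residual vanishes; this gives an equation for the
    Noda value, although the minimum is not smooth. *)
Lemma noda_res_eq0 u : (forall i, 0 < u i 0) ->
  exists i, res A a Gamma u (noda_value A a Gamma u) i 0 = 0.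
Proof.
move=> u0; have [i] := vmin_attained (vdiv (calA A a Gamma u *m u) u).
rewrite -/(noda_value A a Gamma u) /vdiv [RHS]mxE => nE; exists i.
rewrite /res nE [LHS]mxE [X in _ + X]mxE [X in _ - X]mxE.
by rewrite divfK ?subrr // gt_eqF.
Qed.

(* Replacing [calA u] by [jac u] adds the derivative of the saturation term,
   which makes the positive vector [u] a strict witness of monotonicity. *)
Lemma jac_mul_self u lambda i : 0 < a i 0 ->
  (jac A a Gamma u lambda *m u) i 0 = res A a Gamma u lambda i 0
    + Gamma * (2 * u i 0 ^+ 3 / (a i 0 + u i 0 ^+ 2) ^+ 2).
Proof.
move=> a0; rewrite jac_mulE /res [in RHS]mxE [X in _ = _ + X + _]mxE.
rewrite [X in _ = _ - X + _]mxE calA_mulE /sat /dsat.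
by field; rewrite gt_eqF ?addr_sqr_gt0.
Qed.

End Entries.

(** * The bordered Newton system and unit norm of the iterates *)

Section NewtonSystem.
Context {R : realType} {n : nat}.
Variables (A : 'M[R]_n.+1) (a : 'cV[R]_n.+1) (Gamma : R).
Implicit Types (u Delta : 'cV[R]_n.+1) (lambda delta : R).

(** For a unit [u] the right-hand side of the last row is zero, so that row makes [Delta] orthogonal
    to [u]. *)
Lemma newton_systemP u lambda Delta delta : norm2 u = 1 ->
  newton_system A a Gamma u lambda Delta delta ->
  (forall i, (jac A a Gamma u lambda *m Delta) i 0 =
     delta * u i 0 - res A a Gamma u lambda i 0)
  /\ \sum_i u i 0 * Delta i 0 = 0.
Proof.
move=> u1; rewrite /newton_system mul_block_col opp_col_mx => /eq_col_mx[eqJ eqN].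
split=> [i|].
  have /matrixP/(_ i 0) := eqJ; rewrite mulNmx mul_mx_scalar [LHS]mxE.
  by rewrite [X in _ + X]mxE [X in _ - X]mxE [RHS]mxE; lra.
have /matrixP/(_ 0 0) := eqN; rewrite mul0mx addr0 mulNmx.
rewrite [LHS]mxE [in LHS]mxE [RHS]mxE [X in _ = - X]mxE [X in _ = - (_ * X)]mxE.
rewrite [X in _ = - (_ * (X + _))]mxE [X in _ = - (_ * (_ + X))]mxE.
rewrite [X in _ = - (_ * (_ - X))]mxE.
have -> : \sum_j u^T 0 j * u j 0 = 1.
  transitivity (norm2 u ^+ 2); last by rewrite u1 expr1n.
  by rewrite sqr_norm2; apply: eq_bigr => j _; rewrite mxE expr2.
rewrite mulr1n subrr mulr0 => /eqP; rewrite eqr_opp => /eqP; apply: etrans.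
by apply: eq_bigr => j _; rewrite mxE.
Qed.

(** Pythagoras. In particular the vector to be normalized has norm at least 1. *)
Lemma sqr_norm2_wvec u Delta theta : norm2 u = 1 ->
  \sum_i u i 0 * Delta i 0 = 0 ->
  norm2 (wvec u Delta theta) ^+ 2 = 1 + theta ^+ 2 * norm2 Delta ^+ 2.
Proof.
move=> u1 uD; rewrite -(expr1n _ 2) -u1 !sqr_norm2.
transitivity (\sum_i u i 0 ^+ 2 + theta ^+ 2 * (\sum_i Delta i 0 ^+ 2)
    + 2 * theta * \sum_i u i 0 * Delta i 0); last by rewrite uD mulr0 addr0.
rewrite !mulr_sumr -!big_split.
by apply: eq_bigr => i _; rewrite !mxE /=; ring.
Qed.

Lemma norm2_normalize_wvec u Delta theta : norm2 u = 1 ->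
  \sum_i u i 0 * Delta i 0 = 0 ->
  norm2 (normalize (wvec u Delta theta)) = 1.
Proof.
move=> u1 uD; apply: norm2_normalize; apply/eqP => w0.
have := sqr_norm2_wvec theta u1 uD; rewrite w0 norm20 expr0n /= => /eqP.
by rewrite eq_sym gt_eqF // ltr_wpDr // mulr_ge0 // sqr_ge0.
Qed.

Lemma newton_noda_unit eta M (u : nat -> 'cV[R]_n.+1) (lambda : nat -> R)
    (Delta : nat -> 'cV[R]_n.+1) (delta theta : nat -> R) :
  newton_noda A a Gamma eta M u lambda Delta delta theta ->
  forall k, norm2 (u k) = 1.
Proof.
case=> _ u01 _ step; elim=> // k IH; have [nsys _ _ ->] := step k.
have [_ uD] := newton_systemP IH nsys.
exact: norm2_normalize_wvec.
Qed.

End NewtonSystem.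

(** * Uniform estimates near the positive eigenvector *)

Section LocalAnalysis.
Context {R : realType} {n : nat}.
Variables (A : 'M[R]_n.+1) (a : 'cV[R]_n.+1) (Gamma : R).
Variables (us : 'cV[R]_n.+1) (ls : R).
Hypotheses (ZA : Z_matrix A) (a_gt0 : forall i, 0 < a i 0).
Hypothesis Gamma_gt0 : 0 < Gamma.
Hypothesis eigen : calA A a Gamma us *m us = ls *: us.
Hypotheses (us_gt0 : forall i, 0 < us i 0) (us_unit : norm2 us = 1).
Implicit Types (u x Delta : 'cV[R]_n.+1) (lambda delta : R).

Local Notation f u := (calA A a Gamma u *m u).
Local Notation J := (jac A a Gamma).
Local Notation noda := (noda_value A a Gamma).
Local Notation N u := (norm2 (u - us)).

(** A closed-form positive lower bound for half of every entry of [us]. It is both the radius of a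
    ball around [us] and a lower bound for the entries of any vector in that ball. *)
Definition radius : R := 2^-1 * (\sum_i (us i 0)^-1)^-1.
Local Notation m := radius.

Lemma radius_le_half i : m <= 2^-1 * us i 0.
Proof.
rewrite ler_pM2l ?invr_gt0 // -[leRHS]invrK lef_pV2 ?posrE ?invr_gt0 //.
  by apply: (@ler_sum_term _ _ (fun i => (us i 0)^-1)) => j; rewrite invr_ge0 ltW.
apply: (@lt_le_trans _ _ (us i 0)^-1); first by rewrite invr_gt0.
by apply: (@ler_sum_term _ _ (fun i => (us i 0)^-1)) => j; rewrite invr_ge0 ltW.
Qed.

Lemma radius_gt0 : 0 < m.
Proof.
rewrite mulr_gt0 ?invr_gt0 // (@lt_le_trans _ _ (us ord0 0)^-1) ?invr_gt0 //.
by apply: (@ler_sum_term _ _ (fun i => (us i 0)^-1)) => j; rewrite invr_ge0 ltW.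
Qed.

Lemma radius_le_entry u i : N u <= m -> m <= u i 0.
Proof.
move=> uN; have := norm_entry_le (u - us) i; rewrite !mxE ler_norml => /andP[lb _].
by have := radius_le_half i; lra.
Qed.

Lemma unit_entry_le1 u i : norm2 u = 1 -> `|u i 0| <= 1.
Proof. by move=> <-; exact: norm_entry_le. Qed.

(** Bounds from below the extra term of [jac_mul_self]: the entries of [u] are at least [m] in the
    numerator and have square at most 1 in the denominator. *)
Definition jac_lower : R := Gamma * (2 * m ^+ 3 / (\sum_i a i 0 + 1) ^+ 2).
Local Notation c := jac_lower.

Lemma sum_a_gt0 : 0 < \sum_i a i 0 + 1.
Proof. by rewrite ltr_wpDl // sumr_ge0 // => i _; exact: ltW. Qed.

Lemma jac_lower_gt0 : 0 < c.
Proof.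
apply: mulr_gt0 => //; apply: divr_gt0; last by rewrite exprn_gt0 ?sum_a_gt0.
by rewrite mulr_gt0 // exprn_gt0 // radius_gt0.
Qed.

Lemma jac_lower_le u i : norm2 u = 1 -> N u <= m -> c <= (J u (noda u) *m u) i 0.
Proof.
move=> u1 uN; have mu := radius_le_entry i uN; have m0 := radius_gt0.
have u0 : 0 < u i 0 by exact: lt_le_trans mu.
rewrite jac_mul_self // ler_wpDl ?noda_res_ge0 // ler_pM2l //.
apply: ler_pM.
- by rewrite mulr_ge0 // exprn_ge0 // ltW.
- by rewrite invr_ge0 exprn_ge0 // ltW // sum_a_gt0.
- by rewrite ler_pM2l // lerXn2r ?nnegrE // ltW.
have d0 := addr_sqr_gt0 (u i 0) (a_gt0 i).
rewrite lef_pV2 ?posrE ?exprn_gt0 ?sum_a_gt0 // lerXn2r ?nnegrE ?(ltW d0)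
  ?(ltW sum_a_gt0) // lerD //.
  by apply: (@ler_sum_term _ _ (fun i => a i 0)) => j; exact: ltW.
by rewrite -(real_normK (num_real (u i 0))) exprn_ile1 // unit_entry_le1.
Qed.

(** Whatever [lambda], [J u lambda] plus [lambda] times the identity is the derivative of u -> f u.
    The linear parts cancel and leave [Gamma] times the Taylor remainder of [sat], expanded at [u]
    and evaluated at [us]. *)
Lemma taylor_bound : exists2 C, 0 <= C & forall u lambda i, norm2 u = 1 ->
  `|(f u) i 0 - ls * us i 0 - (J u lambda *m (u - us)) i 0
     - lambda * (u - us) i 0| <= C * N u ^+ 2.
Proof.
pose C i := Gamma * ((1 + 3 * a i 0) / a i 0 ^+ 3).
have C0 i : 0 <= C i.
  by rewrite mulr_ge0 ?divr_ge0 ?exprn_ge0 ?addr_ge0 ?mulr_ge0 ?(ltW (a_gt0 i)) // ltW.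
exists (\sum_i C i) => [|u lambda i u1]; first exact: sumr_ge0.
have /matrixP/(_ i 0) := eigen; rewrite [RHS]mxE => <-.
have vE : (u - us) i 0 = u i 0 - us i 0 by rewrite !mxE.
have AvE : (A *m (u - us)) i 0 = (A *m u) i 0 - (A *m us) i 0.
  by rewrite mulmxBr [LHS]mxE [X in _ + X]mxE.
rewrite !calA_mulE jac_mulE AvE vE.
have := sat_taylor (a_gt0 i) (unit_entry_le1 i us_unit) (unit_entry_le1 i u1).
set F := (X in `|X| <= _) => HF.
rewrite [X in `|X|](_ : _ = Gamma * F); last by rewrite /F; ring.
rewrite normrM (gtr0_norm Gamma_gt0).
apply: (@le_trans _ _ (C i * (us i 0 - u i 0) ^+ 2)).
  by rewrite /C -mulrA ler_pM2l.
apply: ler_pM => //; first exact: sqr_ge0.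
  exact: ler_sum_term.
rewrite -(real_normK (num_real (us i 0 - _))) distrC lerXn2r ?nnegrE ?norm2_ge0 //.
by have := norm_entry_le (u - us) i; rewrite !mxE.
Qed.

Definition row_bound : R := \sum_i \sum_j `|A i j|.

Lemma row_bound_ge0 : 0 <= row_bound.
Proof. by apply: sumr_ge0 => i _; apply: sumr_ge0. Qed.

Lemma norm_mulA_le x t i : (forall j, `|x j 0| <= t) ->
  `|(A *m x) i 0| <= row_bound * t.
Proof.
move=> xt; have t0 : 0 <= t by exact: le_trans (xt i).
rewrite mxE (le_trans (ler_norm_sum _ _ _)) //.
apply: (@le_trans _ _ (\sum_j `|A i j| * t)).
  by apply: ler_sum => j _; rewrite normrM ler_wpM2l.
rewrite -mulr_suml ler_wpM2r //.
by apply: (@ler_sum_term _ _ (fun i => \sum_j `|A i j|)) => j; exact: sumr_ge0.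
Qed.

Lemma lipschitz_bound : exists2 C, 0 <= C & forall u i, norm2 u = 1 ->
  `|(f u) i 0 - ls * us i 0| <= C * N u.
Proof.
pose C i := (1 + a i 0) / a i 0 ^+ 2.
have C0 i : 0 <= C i.
  by rewrite divr_ge0 ?exprn_ge0 ?addr_ge0 ?(ltW (a_gt0 i)).
have G0 := ltW Gamma_gt0.
exists (row_bound + Gamma * (1 + \sum_i C i)) => [|u i u1].
  by rewrite addr_ge0 ?row_bound_ge0 ?mulr_ge0 ?addr_ge0 ?sumr_ge0.
have /matrixP/(_ i 0) := eigen; rewrite [RHS]mxE => <-.
rewrite !calA_mulE.
have -> : (A *m u) i 0 + Gamma * (u i 0 - sat (a i 0) (u i 0)) -
    ((A *m us) i 0 + Gamma * (us i 0 - sat (a i 0) (us i 0))) =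
    (A *m (u - us)) i 0 + Gamma * ((u i 0 - us i 0)
      - (sat (a i 0) (u i 0) - sat (a i 0) (us i 0))).
  by rewrite mulmxBr [in RHS]mxE [in X in _ = _ + X + _]mxE; ring.
have uN := norm_entry_le (u - us).
have uNi : `|u i 0 - us i 0| <= N u by have := uN i; rewrite !mxE.
rewrite mulrDl (le_trans (ler_normD _ _)) // lerD ?norm_mulA_le //.
rewrite normrM (gtr0_norm Gamma_gt0) -mulrA ler_pM2l // mulrDl mul1r.
rewrite (le_trans (ler_normB _ _)) // lerD //.
have us1 := unit_entry_le1 i us_unit.
apply: le_trans (sat_lipschitz (a_gt0 i) (unit_entry_le1 i u1) us1) _.
by apply: ler_pM => //; [exact: C0 | exact: ler_sum_term].
Qed.

(** At an index where the residual vanishes, (noda u - ls) u_i is (f u)_i - ls us_i minus ls (u -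
    us)_i. Both are of first order, and u_i >= m allows division. *)
Lemma noda_lipschitz : exists2 C, 0 <= C & forall u, norm2 u = 1 -> N u <= m ->
  `|noda u - ls| <= C * N u.
Proof.
have [C C0 lipC] := lipschitz_bound; have m0 := radius_gt0.
exists ((C + `|ls|) / m) => [|u u1 uN].
  by rewrite divr_ge0 ?(ltW m0) // addr_ge0.
have mu i := radius_le_entry i uN.
have u0 i : 0 < u i 0 by exact: lt_le_trans (mu i).
have [i] := noda_res_eq0 A a Gamma u0.
rewrite /res [LHS]mxE [X in _ + X]mxE [X in _ - X]mxE => /eqP.
rewrite subr_eq0 => /eqP fE.
have := lipC u i u1; rewrite fE.
have -> : noda u * u i 0 - ls * us i 0 =
  (noda u - ls) * u i 0 + ls * (u - us) i 0 by rewrite !mxE; ring.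
move=> Hi; rewrite mulrAC ler_pdivlMr //.
apply: (@le_trans _ _ `|(noda u - ls) * u i 0|).
  by rewrite normrM ler_wpM2l // (gtr0_norm (u0 i)).
rewrite -[X in `|X|](addrK (ls * (u - us) i 0)) (le_trans (ler_normB _ _)) //.
by rewrite [leRHS]mulrDl lerD // normrM ler_wpM2l // norm_entry_le.
Qed.

Lemma jac_bounded : exists2 C, 0 <= C & forall u x t i, norm2 u = 1 -> N u <= m ->
  (forall j, `|x j 0| <= t) -> `|(J u (noda u) *m x) i 0| <= C * t.
Proof.
have [C C0 lipC] := noda_lipschitz; have m0 := radius_gt0.
have G0 := ltW Gamma_gt0; have rb0 := row_bound_ge0.
have a0 i : 0 <= (a i 0)^-1 by rewrite invr_ge0 ltW.
(* Here [|ls| + C * m] bounds the Noda value on the ball, and the last summand comes from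
   [norm_dsat]. *)
exists (row_bound + (Gamma + (`|ls| + C * m)) + Gamma * \sum_i (a i 0)^-1).
  have Cm0 : 0 <= C * m by rewrite mulr_ge0 // ltW.
  have S0 : 0 <= \sum_i (a i 0)^-1 by exact: sumr_ge0.
  by rewrite (addr_ge0 (addr_ge0 rb0 _)) ?mulr_ge0 // addr_ge0 // addr_ge0.
move=> u x t i u1 uN xt; rewrite jac_mulE.
rewrite (le_trans (ler_normB _ _)) // [leRHS]mulrDl lerD //.
  rewrite (le_trans (ler_normD _ _)) // [leRHS]mulrDl lerD ?norm_mulA_le // normrM.
  apply: ler_pM => //.
  rewrite (le_trans (ler_normB _ _)) // lerD ?(gtr0_norm Gamma_gt0) //.
  have -> : noda u = ls + (noda u - ls) by rewrite addrC subrK.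
  rewrite (le_trans (ler_normD _ _)) // lerD2l.
  by apply: le_trans (lipC u u1 uN) _; exact: ler_wpM2l.
rewrite -[leRHS]mulrA normrM (gtr0_norm Gamma_gt0) ler_pM2l // normrM.
apply: ler_pM => //; apply: le_trans (norm_dsat _ (a_gt0 i)) _.
exact: (@ler_sum_term _ _ (fun i => (a i 0)^-1)).
Qed.

Local Notation K := ((1 + c^-1) / m).

Let m_gt0 : 0 < m := radius_gt0.
Let c_gt0 : 0 < c := jac_lower_gt0.

Lemma stability_const_ge0 : 0 <= K.
Proof. by rewrite divr_ge0 ?(ltW m_gt0) // addr_ge0 // invr_ge0 ltW. Qed.

Lemma jac_stable u x k : norm2 u = 1 -> N u <= m -> 0 <= k ->
  (forall i, - k <= (J u (noda u) *m x) i 0) -> \sum_i u i 0 * x i 0 <= k ->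
  forall i, `|x i 0| <= K * k.
Proof.
move=> u1 uN k0; apply: (@Z_matrix_stable _ _ (J u (noda u)) u) => //.
- exact: jac_Z_matrix.
- by move=> i; exact: radius_le_entry.
- by move=> i; exact: jac_lower_le.
Qed.

(* A first-order gap below [ls], whatever the direction of [u - us]: to first
   order [J (u - us) >= - (ls - noda u) us], while [u - us] is orthogonal to
   [u], so stability bounds it by [ls - noda u]. *)
Lemma noda_gap : exists r C, [/\ 0 < r, r <= m, 0 < C &
  forall u, norm2 u = 1 -> N u <= r -> C * N u <= ls - noda u].
Proof.
have [Ct Ct0 taylorC] := taylor_bound.
have [Cl Cl0 lipC] := noda_lipschitz.
pose L := n.+1%:R * K.
have L0 : 0 <= L by rewrite mulr_ge0 // stability_const_ge0.
(* [Ct] pays for the Taylor remainder, the added 1 for the inner product of [u] with [u - us]. *)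
pose C1 := Ct + 1; have C10 : 0 <= C1 by rewrite addr_ge0.
have LC0 : 0 <= L * C1 by rewrite mulr_ge0.
(* On this ball the quadratic term L C1 N^2 is at most N / 2 and can be absorbed on the left. *)
pose r := Num.min m (2 * (L * C1 + 1))^-1.
have d0 : 0 < 2 * (L * C1 + 1) by rewrite mulr_gt0 // ltr_wpDl.
have L1 : 0 < 2 * L + 1 by rewrite ltr_wpDl // mulr_ge0.
exists r, (2 * L + 1)^-1; split; first by rewrite lt_min m_gt0 invr_gt0.
- by rewrite ge_min lexx.
- by rewrite invr_gt0.
move=> u u1; rewrite /r le_min => /andP[uN uN2].
(* The sign of [g] is not known yet, while stability needs a nonnegative [k]; hence the maximum with
   0. *)
set g := ls - noda u; set k := Num.max g 0 + C1 * N u ^+ 2.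
have N0 : 0 <= N u := norm2_ge0 _.
have max0 : 0 <= Num.max g 0 by rewrite le_max lexx orbT.
have NL : N u <= L * k.
  rewrite /L -mulrA; apply: norm2_le; apply: (@jac_stable u) => //.
  - by rewrite addr_ge0 // mulr_ge0 // sqr_ge0.
  - move=> i; have u0 : 0 < u i 0.
      exact: lt_le_trans (radius_le_entry i uN).
    have := noda_res_ge0 A a Gamma u0; have := taylorC u (noda u) i u1.
    rewrite /res [X in _ -> _ <= X -> _]mxE [X in _ -> _ <= _ + X -> _]mxE.
    rewrite [X in _ -> _ <= _ - X -> _]mxE.
    have -> : (u - us) i 0 = u i 0 - us i 0 by rewrite !mxE.
    rewrite ler_norml => /andP[_ tub] res0.
    have us1 : us i 0 <= 1 by rewrite (le_trans (ler_norm _)) // unit_entry_le1.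
    have gus : g * us i 0 <= Num.max g 0.
      have := us_gt0 i; have [g0|g0] := leP g 0; last by nra.
      by move=> ?; rewrite mulr_le0_ge0 // ltW.
    by have := sqr_ge0 (N u); rewrite /k /C1; rewrite /g in gus *; lra.
  - rewrite dot_subr // /k /C1; have := sqr_ge0 (N u); nra.
have NN : L * (C1 * N u ^+ 2) <= 2^-1 * N u.
  have : (L * C1 + 1) * 2 * N u <= 1.
    by move: uN2; rewrite -[(_)^-1]mul1r ler_pdivlMr // mulrC [2 * _]mulrC.
  by nra.
have Nmax : N u <= 2 * L * Num.max g 0 by move: NL; rewrite /k; lra.
rewrite mulrC ler_pdivrMr // mulrC.
have [g0|g0] := leP g 0; last by move: Nmax; rewrite (max_idPl (ltW g0)); lra.
(* If g <= 0, the distance [N u] is 0, and the Lipschitz bound then forces g = 0. *)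
move: Nmax; rewrite (max_idPr g0) mulr0 => Nle0.
have := lipC u u1 uN; have -> : N u = 0 by apply: le_anti; rewrite Nle0.
by rewrite mulr0 normr_le0 subr_eq0 => /eqP gE; rewrite /g gE subrr mulr0.
Qed.

(** With z = u + Delta - us and s = noda u + delta - ls, the Newton equation and the Taylor bound
    give J z = s u up to second order, and u^T z is of second order too. Stability bounds [z], after
    which a single row of J z bounds [s]. *)
Lemma newton_error : exists2 C, 0 <= C & forall u Delta delta,
  norm2 u = 1 -> N u <= m ->
  newton_system A a Gamma u (noda u) Delta delta ->
  (forall i, `|(u + Delta - us) i 0| <= C * N u ^+ 2) /\
  `|noda u + delta - ls| <= C * N u ^+ 2.
Proof.
have [Ct Ct0 taylorC] := taylor_bound.
have [Cl Cl0 lipC] := noda_lipschitz.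
have [Cj Cj0 jacC] := jac_bounded.
have K0 := stability_const_ge0.
pose C1 := Cl + Ct + 1.
have C10 : 0 <= C1 by rewrite !addr_ge0.
have CK0 : 0 <= K * C1 by rewrite mulr_ge0.
have Cs0 : 0 <= (Cj * (K * C1) + C1) / m.
  by rewrite divr_ge0 ?(ltW m_gt0) // addr_ge0 // mulr_ge0.
exists (K * C1 + (Cj * (K * C1) + C1) / m) => [|u Delta delta u1 uN nsys].
  by rewrite addr_ge0.
have [eqJ uD] := newton_systemP u1 nsys.
set z := u + Delta - us; set s := noda u + delta - ls.
have N0 : 0 <= N u := norm2_ge0 _; have N20 := sqr_ge0 (N u).
have zE : z = (u - us) + Delta by rewrite /z addrAC.
have dotz : \sum_i u i 0 * z i 0 = 2^-1 * N u ^+ 2.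
  transitivity (\sum_i u i 0 * (u - us) i 0 + \sum_i u i 0 * Delta i 0).
    rewrite -big_split; apply: eq_bigr => i _.
    by rewrite zE [X in _ * X]mxE mulrDr.
  by rewrite uD addr0 dot_subr.
have Jz i : `|(J u (noda u) *m z) i 0 - s * u i 0| <= C1 * N u ^+ 2.
  have := taylorC u (noda u) i u1.
  have vN := norm_entry_le (u - us) i.
  have gN : `|(noda u - ls) * (u - us) i 0| <= Cl * N u ^+ 2.
    by rewrite normrM expr2 mulrA; apply: ler_pM => //; exact: lipC.
  have -> : (J u (noda u) *m z) i 0 = (J u (noda u) *m (u - us)) i 0
      + (delta * u i 0 - ((f u) i 0 - noda u * u i 0)).
    rewrite zE mulmxDr [LHS]mxE eqJ /res; congr (_ + (_ - _)).
    by rewrite [LHS]mxE [X in _ + X]mxE [X in _ - X]mxE.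
  move: gN.
  have -> : (u - us) i 0 = u i 0 - us i 0 by rewrite !mxE.
  rewrite !ler_norml /s /C1 => /andP[? ?] /andP[? ?].
  by apply/andP; split; lra.
have k0 : 0 <= C1 * N u ^+ 2 by rewrite mulr_ge0.
have u0 i : 0 < u i 0 by exact: lt_le_trans (radius_le_entry i uN).
have zK i : `|z i 0| <= K * C1 * N u ^+ 2.
  (* For s >= 0 the term s u only helps the lower bound on J z; for s < 0 the same argument applies
     to -z. *)
  rewrite -mulrA; have [s0|s0] := leP 0 s.
    apply: (@jac_stable u) => // [j|]; last by rewrite dotz /C1; nra.
    by move: (Jz j); rewrite ler_norml => /andP[? _]; have := u0 j; nra.
  rewrite -normrN -[- z i 0](_ : (- z) i 0 = _); last by rewrite mxE.
  apply: (@jac_stable u) => // [j|].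
    rewrite mulmxN [X in _ <= X]mxE.
    by move: (Jz j); rewrite ler_norml => /andP[_ ?]; have := u0 j; nra.
  under eq_bigr do rewrite mxE mulrN.
  by rewrite sumrN dotz; lra.
split=> [i|].
  by apply: le_trans (zK i) _; rewrite [leRHS]mulrDl lerDl mulr_ge0.
apply: (@le_trans _ _ ((Cj * (K * C1) + C1) / m * N u ^+ 2)); last first.
  by rewrite ler_wpM2r // lerDr.
rewrite [leRHS]mulrAC ler_pdivlMr // [leRHS]mulrDl.
apply: (@le_trans _ _ `|s * u ord0 0|).
  by rewrite normrM ler_wpM2l // (gtr0_norm (u0 _)) radius_le_entry.
have -> : s * u ord0 0 = (J u (noda u) *m z) ord0 0 -
  ((J u (noda u) *m z) ord0 0 - s * u ord0 0) by ring.
by rewrite (le_trans (ler_normB _ _)) // lerD // -[leRHS]mulrA jacC.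
Qed.

(** * Acceptance of the full step and its quadratic error *)

Variables (eta M : R).
Hypotheses (eta_gt0 : 0 < eta) (M_gt0 : 0 < M).
Hypothesis M_bound : remainder_bound A a Gamma M.

(* [delta] is of the order of [norm2 (u - us)] by [noda_gap], whereas the
   remainder [Rvec] is of second order. *)
Lemma newton_noda_step : exists r C, [/\ 0 < r, r <= m, 0 <= C &
  forall u Delta delta, norm2 u = 1 -> N u <= r ->
    newton_system A a Gamma u (noda u) Delta delta ->
    full_step A a Gamma eta u (noda u) Delta delta /\
    N (normalize (wvec u Delta 1)) <= C * N u ^+ 2].
Proof.
have m0 := m_gt0.
have [rg [Cg [rg0 rgm Cg0 gapC]]] := noda_gap.
have [C C0 newtonC] := newton_error.
(* [E] is chosen so that the norm of [Delta] is at most E N, since [Delta] is the new error before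
   normalization minus the old one; [Wb] then bounds the norm of u + Delta. *)
pose E := n.+1%:R * (C * m + 1).
have E0 : 0 <= E by rewrite mulr_ge0 // addr_ge0 // mulr_ge0 // ltW.
pose Wb := 1 + E * m.
have Wb1 : 1 <= Wb by rewrite lerDl mulr_ge0 // ltW.
have Wb0 : 0 < Wb by exact: lt_le_trans Wb1.
pose b := 2^-1 * Cg.
have b0 : 0 < b by rewrite mulr_gt0 // invr_gt0.
pose q := b * (m * (eta / (1 + eta) / Wb)).
have eta1 : 0 < 1 + eta by rewrite addr_gt0.
have q0 : 0 < q by rewrite (mulr_gt0 b0) // (mulr_gt0 m0) // divr_gt0 // divr_gt0.
have ME0 : 0 <= M * E ^+ 2 by rewrite mulr_ge0 ?sqr_ge0 // ltW.
(* The second bound yields delta >= b N, the third M E^2 N <= q, which makes the remainder small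
   enough for acceptance. Adding 1 keeps the denominators positive. *)
pose r := Num.min rg (Num.min (b / (C + 1)) (q / (M * E ^+ 2 + 1))).
exists r, (n.+1%:R * (C + E ^+ 2)); split.
- by rewrite !lt_min rg0 !divr_gt0 // ltr_wpDl.
- by rewrite ge_min rgm.
- by rewrite mulr_ge0 // addr_ge0 ?sqr_ge0.
move=> u Delta delta u1; rewrite /r !le_min => /and3P[uNg uNb uNq] nsys.
have uN : N u <= m := le_trans uNg rgm.
have gN := gapC u u1 uNg.
have [_ uD] := newton_systemP u1 nsys.
have [zC sC] := newtonC u Delta delta u1 uN nsys.
have N0 : 0 <= N u := norm2_ge0 _; have N20 := sqr_ge0 (N u).
have CNb : C * N u <= b.
  by move: uNb; rewrite ler_pdivlMr ?ltr_wpDl //; nra.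
have MENq : M * E ^+ 2 * N u <= q.
  by move: uNq; rewrite ler_pdivlMr ?ltr_wpDl //; nra.
set W := norm2 (wvec u Delta 1); have W0 : 0 <= W := norm2_ge0 _.
have D0 : 0 <= norm2 Delta := norm2_ge0 _.
have DE : norm2 Delta <= E * N u.
  rewrite /E -mulrA; apply: norm2_le => i.
  have -> : Delta i 0 = (u + Delta - us) i 0 - (u - us) i 0 by rewrite !mxE; ring.
  rewrite (le_trans (ler_normB _ _)) // mulrDl mul1r lerD ?norm_entry_le //.
  by apply: le_trans (zC i) _; rewrite expr2 mulrA ler_wpM2r // ler_wpM2l.
have D2 : norm2 Delta ^+ 2 <= E ^+ 2 * N u ^+ 2.
  rewrite -exprMn; apply: lerXn2r; rewrite ?nnegrE //.
  exact: mulr_ge0.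
have W2 : W ^+ 2 = 1 + norm2 Delta ^+ 2.
  by rewrite /W sqr_norm2_wvec // expr1n mul1r.
have W1 : 1 <= W by rewrite -ler_sqr ?nnegrE // W2 expr1n lerDl sqr_ge0.
have Wpos : 0 < W by exact: lt_le_trans W1.
have WWb : W <= Wb.
  have EN : E * N u <= E * m by rewrite ler_wpM2l.
  rewrite -ler_sqr ?nnegrE ?(ltW Wb0) // W2 /Wb; nra.
have deltaN : b * N u <= delta.
  move: sC; rewrite ler_norml => /andP[sC _].
  have : C * N u ^+ 2 <= b * N u by rewrite expr2 mulrA ler_wpM2r.
  by move: gN; rewrite /b; lra.
split.
- apply/forallP => i; apply/forallP => j; rewrite ord1 [X in X <= _]mxE.
  have u0 k : 0 < u k 0 by exact: lt_le_trans (radius_le_entry k uN).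
  have mu := radius_le_entry i uN.
  have u_gt0 : mx_lt 0 u.
    by apply/forallP => k; apply/forallP => l; rewrite ord1 mxE u0.
  have := M_bound u_gt0 u1 nsys (theta := 1).
  rewrite ltr01 lexx expr1n mulr1 => /(_ isT) RM.
  have := le_trans (norm_entry_le _ i) RM.
  rewrite /Rvec subrr mul0r scale0r subr0 mul1r -/W.
  rewrite [X in `|X| <= _]mxE [X in `|_ + X| <= _]mxE [X in `|_ - X| <= _]mxE.
  rewrite ler_norml => /andP[hi _].
  (* At theta = 1 the remainder is [hvec] minus (delta / W) u, so the acceptance threshold leaves a
     margin of eta / (1 + eta) times (delta / W) u. *)
  have -> : delta / ((1 + eta) * W) * u i 0 =
      delta / W * u i 0 - eta / (1 + eta) / W * (delta * u i 0).
    by field; rewrite !gt_eqF.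
  suff : M * norm2 Delta ^+ 2 <= eta / (1 + eta) / W * (delta * u i 0) by lra.
  have du : b * N u * m <= delta * u i 0.
    by apply: ler_pM => //; [rewrite mulr_ge0 // ltW | exact: ltW].
  have eW : eta / (1 + eta) / Wb <= eta / (1 + eta) / W.
    by rewrite ler_wpM2l ?lef_pV2 ?posrE // divr_ge0 // ltW.
  apply: (@le_trans _ _ (eta / (1 + eta) / Wb * (b * N u * m))); last first.
    apply: ler_pM => //; first by rewrite !divr_ge0 // ltW.
    by apply: mulr_ge0; [rewrite mulr_ge0 // ltW | exact: ltW].
  have -> : eta / (1 + eta) / Wb * (b * N u * m) = q * N u by rewrite /q; ring.
  apply: (@le_trans _ _ (M * (E ^+ 2 * N u ^+ 2))); first by rewrite ler_pM2l.
  by rewrite mulrA expr2 mulrA ler_wpM2r.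
- rewrite -mulrA; apply: norm2_le => i.
  (* Normalization adds only a second-order error: 1 - 1/W <= W^2 - 1, which is the squared norm of
     [Delta]. *)
  have -> : (normalize (wvec u Delta 1) - us) i 0 =
      W^-1 * (u + Delta - us) i 0 - us i 0 * (1 - W^-1).
    by rewrite /normalize -/W !mxE mul1r; ring.
  have WV1 : W^-1 <= 1 by rewrite invf_le1.
  have WV0 : 0 <= W^-1 by rewrite invr_ge0.
  rewrite (le_trans (ler_normB _ _)) // mulrDl lerD //.
    rewrite normrM (ger0_norm WV0).
    by apply: le_trans (zC i); rewrite ler_piMl.
  rewrite normrM (@ger0_norm _ (1 - _)) ?subr_ge0 //.
  apply: (@le_trans _ _ (1 - W^-1)).
    by rewrite ler_piMl ?subr_ge0 // unit_entry_le1.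
  apply: le_trans D2.
  have -> : norm2 Delta ^+ 2 = (W - 1) * (W + 1) by rewrite -[LHS](addKr 1) -W2; ring.
  have -> : 1 - W^-1 = (W - 1) * W^-1 by rewrite mulrBl mul1r mulfV ?gt_eqF.
  by rewrite ler_wpM2l ?subr_ge0 // (le_trans WV1) // lerDr.
Qed.

End LocalAnalysis.

(** * Scalar sequences with a quadratic recursion *)

Section Sequences.
Context {R : realType}.
Implicit Types (e : nat -> R) (B C r : R).

Lemma geometric_cvg0 e B k0 : (forall k, 0 <= e k) ->
  (forall j, e (j + k0)%N <= B * 2^-1 ^+ j) -> e k @[k --> \oo] --> (0 : R).
Proof.
move=> e0 eB; rewrite -(@cvg_shiftn k0 R e (nbhs 0)).
apply: (@squeeze_cvgr _ _ _ _ (fun=> 0) (geometric B 2^-1)).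
- by apply: nearW => j /=; rewrite e0 eB.
- exact: cvg_cst.
- by apply: cvg_geometric; rewrite ger0_norm // invf_lt1 // ltr1n.
Qed.

(** As C r <= 1/2, each step from within [r] at least halves the error, so the sequence never leaves
    the region where the recursion holds. *)
Lemma quadratic_geometric e C r k0 : (forall k, 0 <= e k) -> 0 <= C ->
  C * r <= 2^-1 -> e k0 <= r ->
  (forall k, e k <= r -> e k.+1 <= C * e k ^+ 2) ->
  forall j, e (j + k0)%N <= r * 2^-1 ^+ j.
Proof.
move=> e0 C0 Cr er quad; have r0 : 0 <= r := le_trans (e0 k0) er.
elim=> [|j IH]; first by rewrite add0n expr0 mulr1.
have erj : e (j + k0)%N <= r.
  by apply: le_trans IH _; rewrite ler_piMr // exprn_ile1 // invf_le1 // ler1n.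
apply: le_trans (quad _ erj) _; rewrite [in leRHS]exprSr expr2 !mulrA.
apply: (@le_trans _ _ (2^-1 * e (j + k0)%N)).
  by rewrite ler_wpM2r // (le_trans _ Cr) // ler_wpM2l.
by rewrite mulrC ler_wpM2r.
Qed.

End Sequences.

(** * From the local estimates to quadratic convergence of both sequences *)

Lemma norm2_col_mx_le (R : realType) (p q : nat) (u : 'cV[R]_p) (v : 'cV[R]_q) :
  norm2 u <= norm2 (col_mx u v).
Proof.
rewrite -ler_sqr ?nnegrE ?norm2_ge0 // !sqr_norm2 big_split_ord /=.
under [X in _ <= X + _]eq_bigr do rewrite col_mxEu.
by rewrite lerDl sumr_ge0 // => i _; rewrite sqr_ge0.
Qed.

Theorem theorem4p4 (R : realType) (n : nat)
    (A : 'M[R]_n.+1) (a : 'cV[R]_n.+1) (Gamma : R)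
    (irrA : irreducible_mx A) (MA : nonsingular_M_matrix A)
    (a_gt0 : mx_lt 0 a) (Gamma_gt0 : 0 < Gamma)
    (eta M : R) (eta_gt0 : 0 < eta) (M_gt0 : 0 < M)
    (M_bound : remainder_bound A a Gamma M)
    (us : 'cV[R]_n.+1) (ls : R)
    (eigen : calA A a Gamma us *m us = ls *: us)
    (us_gt0 : mx_lt 0 us) (us_unit : norm2 us = 1) :
  exists2 eps : R, 0 < eps &
    forall (u : nat -> 'cV[R]_n.+1) (lambda : nat -> R)
           (Delta : nat -> 'cV[R]_n.+1) (delta theta : nat -> R),
      newton_noda A a Gamma eta M u lambda Delta delta theta ->
      (exists k0 : nat,
         norm2 (col_mx (u k0 - us) (lambda k0 - ls)%:M) < eps) ->
      converges_quadratically (fun x : R => `|x|) lambda ls /\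
      converges_quadratically (@norm2 R n.+1) u us.
Proof.
have a0 i : 0 < a i 0.
  by have /forallP/(_ i)/forallP/(_ 0) := a_gt0; rewrite mxE.
have us0 i : 0 < us i 0.
  by have /forallP/(_ i)/forallP/(_ 0) := us_gt0; rewrite mxE.
have [ZA _ _] := MA.
have [Cl Cl0 lipC] := noda_lipschitz a0 Gamma_gt0 eigen us0 us_unit.
have [rg [Cg [rg0 _ Cg0 gapC]]] := noda_gap ZA a0 Gamma_gt0 eigen us0 us_unit.
have [rs [C [rs0 rsm C0 stepC]]] := newton_noda_step ZA a0 Gamma_gt0 eigen us0
  us_unit eta_gt0 M_gt0 M_bound.
have C1 : 0 < C + 1 by rewrite ltr_wpDl.
(* The first two radii give the gap and the accepted full step; the third gives C eps <= 1/2, so the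
   errors are halved. *)
pose eps := Num.min rg (Num.min rs (2 * (C + 1))^-1).
have eps0 : 0 < eps by rewrite !lt_min rg0 rs0 invr_gt0 mulr_gt0.
have Ceps : C * eps <= 2^-1.
  apply: (@le_trans _ _ (C * (2 * (C + 1))^-1)).
    by rewrite ler_wpM2l // /eps !ge_min lexx !orbT.
  by rewrite ler_pdivrMr ?mulr_gt0 //; lra.
exists eps => // u lambda Delta delta theta iter [k0 close].
have u1 := newton_noda_unit iter; have [_ _ lamE step] := iter.
pose e k := norm2 (u k - us).
have e0 k : 0 <= e k := norm2_ge0 _.
have quad k : e k <= eps -> e k.+1 <= C * e k ^+ 2.
  rewrite /eps !le_min => /and3P[_ ers _].
  have [nsys thetaE _ uE] := step k; rewrite lamE in nsys thetaE.
  have [full errC] := stepC _ _ _ (u1 k) ers nsys.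
  by rewrite /e uE thetaE /step_length full.
have ek0 : e k0 <= eps by apply: le_trans (ltW close); exact: norm2_col_mx_le.
have egeo := quadratic_geometric e0 C0 Ceps ek0 quad.
have e_eps k : (k0 <= k)%N -> e k <= eps.
  move=> /subnK <-; apply: le_trans (egeo _) _.
  by rewrite ler_piMr ?(ltW eps0) // exprn_ile1 // invf_le1 // ler1n.
have lip k : (k0 <= k)%N -> `|lambda k - ls| <= Cl * e k.
  move=> /e_eps; rewrite /eps !le_min => /and3P[_ ers _].
  by rewrite lamE lipC // (le_trans ers).
have gap k : (k0 <= k)%N -> e k <= Cg^-1 * `|lambda k - ls|.
  move=> /e_eps; rewrite /eps le_min => /andP[erg _].
  rewrite mulrC ler_pdivlMr // mulrC; apply: le_trans (gapC _ (u1 k) erg) _.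
  by rewrite -lamE distrC ler_norm.
split; split.
- apply: (@geometric_cvg0 _ _ (Cl * eps) k0) => // j.
  apply: le_trans (lip _ (leq_addl _ _)) _.
  by rewrite -mulrA ler_wpM2l.
(* The eigenvalue error is at most [Cl] times the new vector error, which is at most [C] times the
   square of the old one; the gap turns that back into the old eigenvalue error at the cost of
   [Cg^-1] squared. *)
- exists (Cl * (C * Cg^-1 ^+ 2)); near=> k.
  have k0k : (k0 <= k)%N by near: k; exact: nbhs_infty_ge.
  apply: le_trans (lip _ (leqW k0k)) _.
  rewrite /= -[leRHS]mulrA ler_wpM2l //; apply: le_trans (quad _ (e_eps _ k0k)) _.
  rewrite -[leRHS]mulrA ler_wpM2l // -exprMn; apply: lerXn2r; rewrite ?nnegrE //.
    by rewrite mulr_ge0 // invr_ge0 ltW.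
  exact: gap.
- exact: geometric_cvg0 egeo.
- exists C; near=> k; apply/quad/e_eps.
  by near: k; exact: nbhs_infty_ge.
Unshelve. all: by end_near.
Qed.
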